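(* Let $n\ge1$, $0<s<1$, $p>1$ and $u\in C^{1,1}_{loc}(\mathbb{R}^n)\cap L_{sp}$. For $\lambda\in\mathbb{R}$ let $\Sigma_\lambda=\{x\in\mathbb{R}^n:x_1<\lambda\}$, $x^\lambda=(2\lambda-x_1,x_2,\dots,x_n)$, $u_\lambda(x)=u(x^\lambda)$ and $w_\lambda(x)=u_\lambda(x)-u(x)$. Let $\lambda_o\in\mathbb{R}$ and assume $w_{\lambda_o}(x)>0$ for all $x\in\Sigma_{\lambda_o}$. Suppose $\lambda_k\searrow\lambda_o$ and $x^k\in\Sigma_{\lambda_k}$ are such that $$w_{\lambda_k}(x^k)=\min_{\Sigma_{\lambda_k}}w_{\lambda_k}\le 0\quad\text{and}\quad x^k\to x^o\in\partial\Sigma_{\lambda_o}.$$ Let $\delta_k=\operatorname{dist}(x^k,\partial\Sigma_{\lambda_k})=|\lambda_k-x^k_1|$. Then $$\limsup_{\delta_k\to 0}\frac{1}{\delta_k}\Big\{(-\Delta)^s_p u_{\lambda_k}(x^k)-(-\Delta)^s_p u(x^k)\Big\}<0,$$ where the limit superior is allowed to be $-\infty$.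
   Context: The fractional $p$-Laplacian is $$(-\Delta)^s_p u(x)=C_{n,sp}\,\lim_{\epsilon\to 0}\int_{\mathbb{R}^n\setminus B_\epsilon(x)}\frac{|u(x)-u(y)|^{p-2}[u(x)-u(y)]}{|x-y|^{n+sp}}\,dy,$$ with $C_{n,sp}>0$ a normalizing constant, and $$L_{sp}=\Big\{u\in L^1_{loc}(\mathbb{R}^n)\ :\ \int_{\mathbb{R}^n}\frac{|u(x)|}{1+|x|^{n+sp}}\,dx<\infty\Big\}.$$ *)

(* Defs.v *)
From HB Require Import structures.
From mathcomp Require Import all_boot all_order all_algebra.
From mathcomp Require Import all_classical all_reals all_analysis.
Set Implicit Arguments.
Unset Strict Implicit.
Unset Printing Implicit Defensive.
Import Order.TTheory GRing.Theory Num.Theory.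
Import numFieldNormedType.Exports.
Local Open Scope classical_set_scope.
Local Open Scope ring_scope.

Section FracPLap.
Variable R : realType.

(* Euclidean norm on R^N (the library's norm on 'rV is the sup norm). *)
Definition enorm (N : nat) (v : 'rV[R]_N) : R :=
  Num.sqrt (\sum_(i < N) v 0 i ^+ 2).

(* Lebesgue integral over R^N of a nonnegative extended-real function,
   as the iterated integral over the N coordinates (Tonelli). *)
Fixpoint lebN_int (N : nat) : ('rV[R]_N -> \bar R) -> \bar R :=
  match N return ('rV[R]_N -> \bar R) -> \bar R with
  | 0 => fun f => f 0
  | M.+1 => fun f =>
      (\int[@lebesgue_measure R]_t
          lebN_int (fun y : 'rV[R]_M => f (row_mx (\row_(_ < 1) t) y)))%E
  end.

Definition lebN_sint (N : nat) (f : 'rV[R]_N -> R) : \bar R :=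
  (lebN_int (fun y => (Num.max (f y) 0)%:E)
   - lebN_int (fun y => (Num.max (- f y) 0)%:E))%E.

Definition L_sp (N : nat) (s p : R) (u : 'rV[R]_N -> R) : Prop :=
  (forall (c : 'rV[R]_N) (r : R),
      (lebN_int (fun y => (if enorm (y - c) < r then `|u y| else 0)%:E)
        < +oo)%E) /\
  (lebN_int (fun y => (`|u y| / (1 + enorm y `^ (N%:R + s * p)))%:E)
     < +oo)%E.

Definition partialD (N : nat) (u : 'rV[R]_N -> R) (i : 'I_N) (x : 'rV[R]_N) : R :=
  'D_(delta_mx 0 i) u x.

Definition C11_loc (N : nat) (u : 'rV[R]_N -> R) : Prop :=
  (forall x, differentiable u x) /\
  (forall r : R, 0 < r -> exists L : R, forall x y : 'rV[R]_N,
      enorm x <= r -> enorm y <= r ->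
      forall i, `|partialD u i x - partialD u i y| <= L * enorm (x - y)).

Definition fracpLap_integrand (N : nat) (s p : R) (u : 'rV[R]_N -> R)
    (x : 'rV[R]_N) (eps : R) (y : 'rV[R]_N) : R :=
  if eps <= enorm (x - y) then
    `|u x - u y| `^ (p - 2) * (u x - u y) / enorm (x - y) `^ (N%:R + s * p)
  else 0.

Definition fracpLap_trunc (N : nat) (C s p : R) (u : 'rV[R]_N -> R)
    (x : 'rV[R]_N) (eps : R) : \bar R :=
  ((C%:E) * lebN_sint (fracpLap_integrand s p u x eps))%E.

Definition fracpLap_exists (N : nat) (C s p : R) (u : 'rV[R]_N -> R)
    (x : 'rV[R]_N) : Prop :=
  exists l : R, fracpLap_trunc C s p u x eps @[eps --> 0^'+] --> l%:E.

Definition fracpLap (N : nat) (C s p : R) (u : 'rV[R]_N -> R)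
    (x : 'rV[R]_N) : R :=
  fine (lim (fracpLap_trunc C s p u x eps @[eps --> 0^'+])).

Definition x1 (n : nat) (x : 'rV[R]_n.+1) : R := x 0 ord0.

Definition Sigma (n : nat) (lam : R) : set 'rV[R]_n.+1 := [set x | x1 x < lam].

Definition refl (n : nat) (lam : R) (x : 'rV[R]_n.+1) : 'rV[R]_n.+1 :=
  \row_i (if i == ord0 then 2 * lam - x 0 i else x 0 i).

Definition u_lam (n : nat) (u : 'rV[R]_n.+1 -> R) (lam : R) :=
  fun x => u (refl lam x).

Definition w_lam (n : nat) (u : 'rV[R]_n.+1 -> R) (lam : R) :=
  fun x => u_lam u lam x - u x.

End FracPLap.

(* Main.v *)
Require Import Defs.
From HB Require Import structures.
From mathcomp Require Import all_boot all_order all_algebra.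
From mathcomp Require Import all_classical all_reals all_analysis.
From mathcomp Require Import measurable_realfun ring lra.
Set Implicit Arguments.
Unset Strict Implicit.
Import Order.TTheory GRing.Theory Num.Theory.
Import numFieldNormedType.Exports.
Local Open Scope classical_set_scope.
Local Open Scope ring_scope.

(* Write G(t) = |t|^(p-2) t and q = n + sp.  Folding the integral over the
   reflection y -> y^lam turns the difference of the two fractional
   p-Laplacians at x = x^k into an integral over y in Sigma_lam of
     [G(u_lam(x) - u_lam(y)) - G(u(x) - u(y))] / |x - y|^q
     + [G(u_lam(x) - u(y)) - G(u(x) - u_lam(y))] / |x - y^lam|^q.
   As x minimizes w_lam and w_lam(x) <= 0, monotonicity of G bounds the
   integrand by the first bracket times |x - y|^-q - |x - y^lam|^-q, which is
   never positive.  On a fixed small box inside Sigma_lam_o the bracket stays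
   below a negative constant (as w_lam_o > 0 there) and the kernel difference is
   at least a constant times delta_k.  Truncating at eps leaves an unpaired
   contribution from the reflected ball, of size O(eps^n) for fixed k. *)

(** * Measurability of functions on R^N *)

(* Measurability of a function on R^N is tested on all coordinatewise
   measurable maps into R^N, so that no sigma-algebra on 'rV is needed. *)
Definition mfun_rV {R : realType} {N : nat} {d'} {Y : measurableType d'}
    (f : 'rV[R]_N -> Y) : Prop :=
  forall d (T : measurableType d) (h : T -> 'rV[R]_N),
    (forall i, measurable_fun setT (fun t => h t 0 i)) ->
    measurable_fun setT (f \o h).

(** Rounding [h] to a grid leaves countably many values of [u], each taken on a set cut out by
    finitely many coordinate inequalities; by continuity of [u] these functions converge pointwise
    to [u \o h] as the mesh shrinks. *)
Lemma mfun_rV_continuous {R : realType} {N : nat} (u : 'rV[R]_N -> R) :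
  continuous u -> mfun_rV u.
Proof.
move=> cu d T h mh.
(* Discretize on the grid of mesh 1/(m+1). *)
pose fl (m : nat) (v : 'rV[R]_N) : 'rV[int]_N :=
  \row_i Num.floor (m.+1%:R * v 0 i).
pose gr (m : nat) (z : 'rV[int]_N) : 'rV[R]_N :=
  \row_i ((z 0 i)%:~R / m.+1%:R).
have cell m (z : 'rV[int]_N) : measurable [set t | fl m (h t) = z].
  rewrite (_ : [set t | _] = \bigcap_(i in [set: 'I_N])
      [set t | (z 0 i)%:~R <= m.+1%:R * h t 0 i < (z 0 i + 1)%:~R]); last first.
    apply/seteqP; split => t /=.
      by move=> <- i _ /=; rewrite !mxE floor_itv.
    by move=> H; apply/rowP => i; rewrite mxE; apply/floor_def/H.
  apply: fin_bigcap_measurable => // i _.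
  rewrite -[X in measurable X]setTI.
  have : measurable_fun setT
      (fun t => (z 0 i)%:~R <= m.+1%:R * h t 0 i < (z 0 i + 1)%:~R).
    apply: measurable_and.
      by apply: measurable_fun_ler => //; exact: measurable_funM.
    by apply: measurable_fun_ltr => //; exact: measurable_funM.
  by move=> /(_ measurableT [set true]); apply.
apply: (@measurable_fun_cvg _ _ _ _ (fun m t => u (gr m (fl m (h t))))).
  move=> m _ Y mY; rewrite setTI.
  rewrite (_ : _ @^-1` Y =
      \bigcup_z ([set t | fl m (h t) = z /\ Y (u (gr m z))])); last first.
    apply/seteqP; split => t /=; first by move=> Yt; exists (fl m (h t)).
    by move=> [z _ /= [<-]].
  apply: countable_bigcupT_measurable; first exact: countableP.
  move=> z; have [Yz|Yz] := pselect (Y (u (gr m z))).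
    by rewrite (_ : [set t | _] = [set t | fl m (h t) = z]);
      [exact: cell|apply/seteqP; split => t //= []].
  by rewrite (_ : [set t | _] = set0) //; apply/seteqP; split => t //= [].
move=> t _.
suff : gr m (fl m (h t)) @[m --> \oo] --> h t.
  by move=> grh; apply: (cvg_comp _ _ grh (cu (h t))).
apply/cvg_ballP => e e0; near=> m.
split => // i j; rewrite !mxE ord1 /ball/=.
have /andP[F1 F2] := floor_itv (m.+1%:R * h t 0 j).
set z := Num.floor _ in F1 F2 *.
have m0 : (0 : R) < m.+1%:R by rewrite ltr0n.
have F3 : m.+1%:R^-1 < e.
  by near: m; exact: (near_infty_natSinv_lt (PosNum e0)).
rewrite ger0_norm; last by rewrite subr_ge0 ler_pdivrMr// mulrC.
apply: le_lt_trans F3.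
rewrite lerBlDr -[X in X + _]mul1r -mulrDl ler_pdivlMr// mulrC.
by rewrite addrC (le_trans (ltW F2))// intrD.
Unshelve. all: by end_near.
Qed.

Lemma mfun_rV_row_mx {R : realType} {N : nat} {d'} {Y : measurableType d'}
    (f : 'rV[R]_N.+1 -> Y) d (T : measurableType d) (g : T -> R)
    (h : T -> 'rV[R]_N) :
  mfun_rV f -> measurable_fun setT g ->
  (forall i, measurable_fun setT (fun t => h t 0 i)) ->
  measurable_fun setT (fun t => f (row_mx (\row_(_ < 1) g t) (h t))).
Proof.
move=> mf mg mh; apply: (mf _ _ (fun t => row_mx (\row_(_ < 1) g t) (h t))).
move=> i; case: (@split_ordP 1 N i) => j ->.
  by under eq_fun do rewrite (@row_mxEl _ 1 1 N) mxE.
by under eq_fun do rewrite (@row_mxEr _ 1 1 N); exact: mh.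
Qed.

Lemma mfun_rV_section {R : realType} {N : nat} {d'} {Y : measurableType d'}
    (f : 'rV[R]_N.+1 -> Y) (t : R) :
  mfun_rV f -> mfun_rV (fun y : 'rV[R]_N => f (row_mx (\row_(_ < 1) t) y)).
Proof. by move=> mf d T h mh; exact: mfun_rV_row_mx. Qed.

(** * The iterated Lebesgue integral *)

Lemma lebN_int_ge0 {R : realType} {N : nat} (f : 'rV[R]_N -> \bar R) :
  (forall y, (0 <= f y)%E) -> (0 <= lebN_int f)%E.
Proof.
elim: N f => [|N IH] f f0 /=; first exact: f0.
by apply: integral_ge0 => t _; apply: IH.
Qed.

(** The parameter type is arbitrary so that the induction on [N] can absorb the outer integration
    variable into it, passing from [T] to [T * R]; Tonelli then integrates that variable out. *)
Lemma measurable_lebN_int_param {R : realType} {N : nat} {d}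
    (T : measurableType d) (f : T -> 'rV[R]_N -> \bar R) :
  (forall t y, (0 <= f t y)%E) ->
  (forall d' (S : measurableType d') (g : S -> T) (h : S -> 'rV[R]_N),
     measurable_fun setT g ->
     (forall i, measurable_fun setT (fun s => h s 0 i)) ->
     measurable_fun setT (fun s => f (g s) (h s))) ->
  measurable_fun setT (fun t => lebN_int (f t)).
Proof.
elim: N d T f => [|N IH] d T f f0 mf /=.
  by apply: (mf _ _ id (fun=> 0)).
have := IH _ (T * measurableTypeR R)%type
  (fun ts y => f ts.1 (row_mx (\row_(_ < 1) ts.2) y)).
move=> /(_ (fun _ _ => f0 _ _)) IHf.
apply: (@measurable_fun_fubini_tonelli_F _ _ _ _ _ (@lebesgue_measure R)
  (fun ts => lebN_int (fun y => f ts.1 (row_mx (\row_(_ < 1) ts.2) y)))).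
  apply: IHf => d' S g h mg mh.
  apply: (mf _ _ (fun s => (g s).1)
                 (fun s => row_mx (\row_(_ < 1) (g s).2) (h s))).
    exact: (measurableT_comp measurable_fst mg).
  move=> i; case: (@split_ordP 1 N i) => j ->.
    under eq_fun do rewrite (@row_mxEl _ 1 1 N) mxE.
    exact: (measurableT_comp measurable_snd mg).
  by under eq_fun do rewrite (@row_mxEr _ 1 1 N); exact: mh.
by move=> ts; apply: lebN_int_ge0 => y; exact: f0.
Qed.

Lemma measurable_lebN_int_section {R : realType} {N : nat}
    (f : 'rV[R]_N.+1 -> \bar R) :
  (forall y, (0 <= f y)%E) -> mfun_rV f ->
  measurable_fun (setT : set (measurableTypeR R))
    (fun t : measurableTypeR R =>
       lebN_int (fun y : 'rV[R]_N => f (row_mx (\row_(_ < 1) t) y))).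
Proof.
move=> f0 mf; apply: measurable_lebN_int_param => [//|d' S g h mg mh].
exact: mfun_rV_row_mx.
Qed.

Lemma le_lebN_int {R : realType} {N : nat} (f g : 'rV[R]_N -> \bar R) :
  (forall y, (0 <= f y)%E) -> mfun_rV f -> mfun_rV g ->
  (forall y, (f y <= g y)%E) -> (lebN_int f <= lebN_int g)%E.
Proof.
elim: N f g => [|N IH] f g f0 mf mg fg /=; first exact: fg.
have g0 y : (0 <= g y)%E by exact: le_trans (fg y).
apply: ge0_le_integral => //.
- by move=> t _; exact: lebN_int_ge0.
- exact: measurable_lebN_int_section.
- exact: measurable_lebN_int_section.
- by move=> t _; apply: IH => //; exact: mfun_rV_section.
Qed.

Lemma lebN_intD {R : realType} {N : nat} (f g : 'rV[R]_N -> \bar R) :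
  (forall y, (0 <= f y)%E) -> (forall y, (0 <= g y)%E) ->
  mfun_rV f -> mfun_rV g ->
  lebN_int (fun y => f y + g y)%E = (lebN_int f + lebN_int g)%E.
Proof.
elim: N f g => [//|N IH] f g f0 g0 mf mg /=.
rewrite -ge0_integralD//=.
- apply: eq_integral => t _.
  by rewrite -IH //; exact: mfun_rV_section.
- by move=> t _; exact: lebN_int_ge0.
- exact: measurable_lebN_int_section.
- by move=> t _; exact: lebN_int_ge0.
- exact: measurable_lebN_int_section.
Qed.

(** The image of Lebesgue measure under [t |-> c - t] has the right value on intervals, so it is
    Lebesgue measure by uniqueness. *)
Lemma lebesgue_integral_reflection {R : realType} (c : R)
    (F : measurableTypeR R -> \bar R) :
  (forall t, (0 <= F t)%E) -> measurable_fun setT F ->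
  (\int[@lebesgue_measure R]_t F (c - t)%R = \int[@lebesgue_measure R]_t F t)%E.
Proof.
move=> F0 mF.
pose phi : measurableTypeR R -> measurableTypeR R := fun t => c - t.
have mphi : measurable_fun setT phi by exact: measurable_funB.
have := @ge0_integral_pushforward _ _ _ _ R phi mphi (@lebesgue_measure R)
  setT F measurableT mF (fun y _ => F0 y).
rewrite preimage_setT => <-.
apply: eq_measure_integral => A mA _.
apply/esym/(@lebesgue_measure_unique R (pushforward (@lebesgue_measure R) phi)) => //.
move=> X [[a b] _ <-] /=.
rewrite /pushforward.
rewrite (_ : phi @^-1` _ = `[c - b, c - a[%classic).
    rewrite !lebesgue_measure_itv /= !lte_fin.
  have -> : (c - b < c - a) = (a < b) by apply/idP/idP; lra.
  by case: ifP => // _; rewrite -!EFinD; congr EFin; lra.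
apply/seteqP; split=> t; rewrite /phi /= !in_itv /=; lra.
Qed.

(** [refl] moves only coordinate 0, which is the outermost integration variable, so the
    one-dimensional reflection suffices. *)
Lemma lebN_int_refl {R : realType} {N : nat} (lam : R)
    (f : 'rV[R]_N.+1 -> \bar R) :
  (forall y, (0 <= f y)%E) -> mfun_rV f ->
  lebN_int (fun y => f (refl lam y)) = lebN_int f.
Proof.
move=> f0 mf /=.
rewrite -[RHS](lebesgue_integral_reflection (2 * lam)).
- apply: eq_integral => t _; congr lebN_int; apply/funext => y; congr f.
  apply/rowP => i; rewrite mxE; case: (@split_ordP 1 N i) => j ->.
    by rewrite !(@row_mxEl _ 1 1 N) !mxE (ord1 j) -val_eqE.
  by rewrite !(@row_mxEr _ 1 1 N) -val_eqE.
- by move=> t; exact: lebN_int_ge0.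
- exact: measurable_lebN_int_section.
Qed.

(** Closed cubes rather than Euclidean balls: their indicators factor over the coordinates, which
    suits iterated integrals, and they match the sup norm topology on row vectors. *)
Definition in_box {R : realType} {N : nat} (z : 'rV[R]_N) (r : R) (y : 'rV[R]_N)
  : bool := [forall i, `|y 0 i - z 0 i| <= r].

Lemma mfun_rV_in_box {R : realType} {N : nat} (z : 'rV[R]_N) (r : R) :
  mfun_rV (in_box z r).
Proof.
move=> d T h mh; apply: (measurable_fun_bool true); rewrite ?setTI.
rewrite (_ : _ @^-1` _ = \bigcap_(i in [set: 'I_N])
    [set t | `|h t 0 i - z 0 i| <= r]); last first.
  apply/seteqP; split => t /=; first by move=> /forallP H i _; exact: H.
  by move=> H; apply/forallP => i; exact: H.
apply: fin_bigcap_measurable => // i _.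
rewrite -[X in measurable X]setTI; apply: measurable_fun_le => //.
by apply: measurableT_comp => //; exact: measurable_funB.
Qed.

Lemma lebN_int_box {R : realType} {N : nat} (z : 'rV[R]_N) (r c : R) :
  0 <= r -> 0 <= c ->
  lebN_int (fun y => (if in_box z r y then c else 0)%:E) = (c * (2 * r) ^+ N)%:E.
Proof.
move=> r0; elim: N z c => [|N IH] z c c0 /=.
  rewrite expr0 mulr1 ifT//; by apply/forallP => -[].
pose z' : 'rV[R]_N := \row_i z 0 (rshift 1 i).
pose z0 := z 0 (lshift N (ord0 : 'I_1)).
transitivity (\int[lebesgue_measure]_t
   (((c * (2 * r) ^+ N)%:E * (\1_(`[z0 - r, z0 + r]%classic : set (measurableTypeR R)) t)%:E)))%E.
  apply: eq_integral => t _.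
  rewrite indicE.
  have E y : in_box z r (row_mx (\row_(_ < 1) t) y) =
             (t \in (`[z0 - r, z0 + r]%classic : set R)) && in_box z' r y.
    rewrite mem_setE in_itv/= -ler_distlC.
    apply/forallP/andP => [H|[H1 /forallP H2] i].
      split; first by have := H (lshift N (ord0 : 'I_1)); rewrite (@row_mxEl _ 1 1 N) mxE distrC.
      apply/forallP => i; have := H (rshift 1 i).
      by rewrite (@row_mxEr _ 1 1 N) mxE.
    case: (@split_ordP 1 N i) => j ->; first by rewrite (@row_mxEl _ 1 1 N) mxE (ord1 j) distrC.
    by have := H2 j; rewrite (@row_mxEr _ 1 1 N) mxE.
  under [X in lebN_int X]eq_fun do rewrite E.
  case: (t \in _) => /=; first by rewrite mule1 IH.
  (* Off the interval the section is zero, which is the induction hypothesis for the constant 0. *)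
  transitivity ((0 * (2 * r) ^+ N)%:E : \bar R)%R; last by rewrite mul0r mule0.
  rewrite -(IH z' 0) //; congr lebN_int.
  by apply/funext => y; case: ifP.
rewrite ge0_integralZl//=; last 2 first.
- by apply/measurable_EFinP; apply: measurable_indic; exact: measurable_itv.
- by rewrite lee_fin mulr_ge0 // exprn_ge0 // mulr_ge0.
rewrite integral_indic ?setIT//.
rewrite [X in (_ * X)%E](@lebesgue_measure_itv R) /= lte_fin.
case: ifPn => [_|H].
  rewrite -EFinD -EFinM exprS; congr EFin; ring.
(* Degenerate cube: both sides vanish because the dimension is positive. *)
have -> : r = 0 by lra.
by rewrite mule0 mulr0 exprS mul0r mulr0.
Qed.

(** * Signed powers and the gap between two kernels *)

(** The function G of the overview; the factor [t] makes it 0 at 0 for every [p]. *)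
Definition spow {R : realType} (p t : R) : R := `|t| `^ (p - 2) * t.

Lemma spowN {R : realType} (p t : R) : spow p (- t) = - spow p t.
Proof. by rewrite /spow normrN mulrN. Qed.

Lemma spow_powR {R : realType} (p t : R) :
  1 < p -> 0 <= t -> spow p t = t `^ (p - 1).
Proof.
move=> p1 t0; rewrite /spow ger0_norm// mulrC.
rewrite -(@mulr_powRB1 R t (p - 1))// ?subr_gt0//; congr (_ * _ `^ _); lra.
Qed.

(** On the nonnegative half-line this is a power with positive exponent [p - 1]; oddness handles two
    negative arguments, and opposite signs are compared through 0. *)
Lemma spow_lt {R : realType} (p a b : R) : 1 < p -> a < b -> spow p a < spow p b.
Proof.
move=> p1.
have p0 : 0 < p - 1 by rewrite subr_gt0.
have pos c d : 0 <= c -> c < d -> spow p c < spow p d.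
  move=> c0 cd; rewrite !spow_powR//; last lra.
  by apply: gt0_ltr_powR => //; rewrite nnegrE//; lra.
have s0 : spow p 0 = 0 :> R by rewrite /spow mulr0.
have [a0|a0] := leP 0 a; first exact: pos.
have [b0 _|b0 ab] := leP 0 b.
  apply: (@lt_le_trans _ _ 0).
    by have := pos 0 (- a); rewrite s0 spowN; lra.
  by rewrite spow_powR// powR_ge0.
by have := pos (- b) (- a); rewrite !spowN; lra.
Qed.

Lemma spow_le {R : realType} (p a b : R) : 1 < p -> a <= b -> spow p a <= spow p b.
Proof.
by move=> p1; rewrite le_eqVlt => /predU1P[->//|/(spow_lt p1)/ltW].
Qed.

Lemma powR_inv_gap {R : realType} (q d d' D : R) :
  0 < q -> 0 < d -> d <= d' -> d' <= D ->
  q * (d' - d) / (D * D `^ q) <= (d `^ q)^-1 - (d' `^ q)^-1.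
Proof.
move=> q0 d0 dd' d'D.
have d'0 : 0 < d' by exact: lt_le_trans dd'.
have D0 : 0 < D by exact: lt_le_trans d'D.
(* (d'/d)^q - 1 >= q ln (d'/d) >= q (1 - d/d') *)
have ratio : d' `^ q / d `^ q = expR (- q * ln (d / d')).
  rewrite /powR !gt_eqF// -expRN -expRD lnM ?posrE ?invr_gt0// lnV ?posrE//.
  by congr expR; ring.
have ln_le : ln (d / d') <= d / d' - 1.
  have := @le_ln1Dx R (d / d' - 1).
  rewrite [1 + _]addrC subrK; apply.
  by rewrite ltrBrDr addNr divr_gt0.
have ratio_ge : 1 + q * (1 - d / d') <= d' `^ q / d `^ q.
  rewrite ratio; apply: le_trans (expR_ge1Dx _).
  by rewrite lerD2l mulNr -mulrN ler_pM2l//; lra.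
have pd : 0 < d `^ q by exact: powR_gt0.
have pd' : 0 < d' `^ q by exact: powR_gt0.
have pD : 0 < D `^ q by exact: powR_gt0.
have -> : (d `^ q)^-1 - (d' `^ q)^-1 = (d' `^ q / d `^ q - 1) / d' `^ q.
  by field; rewrite !gt_eqF.
apply: (@le_trans _ _ (q * (1 - d / d') / d' `^ q)); last first.
  by rewrite ler_pM2r ?invr_gt0//; lra.
have -> : q * (1 - d / d') / d' `^ q = q * (d' - d) / (d' * d' `^ q).
  by field; rewrite !gt_eqF.
apply: ler_wpM2l; first by rewrite mulr_ge0 ?subr_ge0// ltW.
rewrite lef_pV2 ?posrE ?mulr_gt0//.
apply: ler_pM => //; [exact: ltW|exact: ltW|].
by apply: ge0_ler_powR => //; rewrite ?nnegrE ltW.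
Qed.

(** Since [d' + d <= 2 * D], the relation between the squares gives [d' - d >= 2 * h / D]. In the
    application [h] is the product of the distances of two points to the hyperplane. *)
Lemma powR_inv_gap_sqr {R : realType} (q d d' D h : R) :
  0 < q -> 0 < d -> 0 <= d' -> d <= D -> d' <= D -> 0 <= h ->
  d' ^+ 2 = d ^+ 2 + 4 * h ->
  2 * q / (D * D * D `^ q) * h <= (d `^ q)^-1 - (d' `^ q)^-1.
Proof.
move=> q0 d0 d'0 dD d'D h0 E.
have D0 : 0 < D by exact: lt_le_trans dD.
have dd' : d <= d'.
  by rewrite -(@ler_pXn2r _ 2)// ?nnegrE; [rewrite E; lra|exact: ltW].
apply: le_trans (powR_inv_gap q0 d0 dd' d'D).
have pD : 0 < D `^ q by exact: powR_gt0.
have -> : 2 * q / (D * D * D `^ q) * h = q * (2 * h / D) / (D * D `^ q).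
  by field; rewrite !gt_eqF.
rewrite ler_pM2r ?invr_gt0 ?mulr_gt0// ler_pM2l// ler_pdivrMr//.
nra.
Qed.

(** * Euclidean norm, reflections and cubes *)

Section EuclideanNorm.
Context {R : realType} {N : nat}.
Implicit Types v : 'rV[R]_N.

Lemma enorm_ge0 v : 0 <= enorm v.
Proof. exact: sqrtr_ge0. Qed.

Lemma enorm_sqr v : enorm v ^+ 2 = \sum_(i < N) v 0 i ^+ 2.
Proof. by rewrite sqr_sqrtr// sumr_ge0// => i _; exact: sqr_ge0. Qed.

Lemma coord_le_enorm v i : `|v 0 i| <= enorm v.
Proof.
rewrite -(@ler_pXn2r _ 2)// ?nnegrE ?enorm_ge0// real_normK ?num_real//.
rewrite enorm_sqr (bigD1 i)//= lerDl sumr_ge0// => j _; exact: sqr_ge0.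
Qed.

Lemma enorm_le v (m : R) :
  0 <= m -> (forall i, `|v 0 i| <= m) -> enorm v <= Num.sqrt (N%:R * m ^+ 2).
Proof.
move=> m0 vm; rewrite ler_wsqrtr//.
rewrite -[N in N%:R]card_ord -sum1_card natr_sum mulr_suml ler_sum// => i _.
by rewrite mul1r -(real_normK (num_real (v 0 i))) ler_pXn2r ?nnegrE.
Qed.

End EuclideanNorm.

Section Reflection.
Context {R : realType} {n : nat}.
Implicit Types (x y z : 'rV[R]_n.+1) (lam : R).

Lemma reflK lam : involutive (@refl R n lam).
Proof.
by move=> x; apply/rowP => i; rewrite !mxE; case: eqP => // _; ring.
Qed.

Lemma x1_refl lam x : x1 (refl lam x) = 2 * lam - x1 x.
Proof. by rewrite /x1 mxE eqxx. Qed.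

(** Only the first coordinate contributes: with a and b the two signed distances to the hyperplane,
    (a + b)^2 - (a - b)^2 = 4ab. This is where the factor delta_k comes from. *)
Lemma enorm_refl_sqr lam x y :
  enorm (x - refl lam y) ^+ 2 =
  enorm (x - y) ^+ 2 + 4 * ((lam - x1 x) * (lam - x1 y)).
Proof.
rewrite !enorm_sqr !big_ord_recl !mxE eqxx /x1.
rewrite (eq_bigr (fun i => (x - y) 0 (lift ord0 i) ^+ 2)); last first.
  by move=> i _; rewrite !mxE.
ring.
Qed.

(** The first coordinate moves by at most [r] from [y] and [2 * r] from the change of hyperplane,
    hence the factor 3. *)
Lemma refl_in_box lam lam' r z y :
  0 <= r -> in_box z r y -> `|lam' - lam| <= r ->
  in_box (refl lam z) (3 * r) (refl lam' y).
Proof.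
move=> r0 /forallP zy ll; apply/forallP => i; have := zy i; rewrite !mxE.
move: ll; rewrite !ler_norml; case: eqP => _; lra.
Qed.

Lemma mfun_rV_refl {d'} {Y : measurableType d'} lam (f : 'rV[R]_n.+1 -> Y) :
  mfun_rV f -> mfun_rV (fun y => f (refl lam y)).
Proof.
move=> mf d T h mh; apply: (mf _ _ (fun t => refl lam (h t))) => i.
under eq_fun do rewrite mxE.
by case: (i == ord0); [exact: measurable_funB|exact: mh].
Qed.

End Reflection.

Section Boxes.
Context {R : realType} {N : nat}.
Implicit Types z y : 'rV[R]_N.

Lemma in_box_nbhs z (A : set 'rV[R]_N) :
  nbhs z A -> exists2 r : R, 0 < r & forall y, in_box z r y -> A y.
Proof.
move=> /nbhs_ballP[e /= e0 eA]; exists (e / 2); first by rewrite divr_gt0.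
move=> y /forallP zy; apply: eA; split => // i j; rewrite /ball/= ord1 distrC.
by apply: le_lt_trans (zy j) _; lra.
Qed.

Lemma nbhs_in_box z (r : R) : 0 < r -> nbhs z [set y | in_box z r y].
Proof.
move=> r0; apply/nbhs_ballP; exists r => // y [_ zy]; apply/forallP => i.
by rewrite distrC ltW//; exact: zy.
Qed.

Lemma in_boxW z y (r r' : R) : r <= r' -> in_box z r y -> in_box z r' y.
Proof.
by move=> rr /forallP zy; apply/forallP => i; exact: le_trans (zy i) rr.
Qed.

Lemma continuous_in_box (u : 'rV[R]_N -> R) z (eta : R) :
  continuous u -> 0 < eta ->
  exists2 r : R, 0 < r & forall y, in_box z r y -> `|u y - u z| <= eta.
Proof.
move=> cu eta0.
apply: (@in_box_nbhs z [set y | `|u y - u z| <= eta]).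
exact: (@cvgr_distC_le _ _ _ _ _ u (u z) (cu z)).
Qed.

(** Encloses the truncated Euclidean ball in a cube, whose volume [lebN_int_box] computes. *)
Lemma enorm_lt_in_box z y (e : R) : enorm (z - y) < e -> in_box z e y.
Proof.
move=> zy; apply/forallP => i; rewrite distrC.
apply: le_trans (ltW zy); apply: le_trans (coord_le_enorm _ i).
by rewrite !mxE.
Qed.

End Boxes.

(** * The truncated integrand and its estimate on reflected pairs *)

Lemma mfun_rV_enorm {R : realType} {N : nat} (x : 'rV[R]_N) :
  mfun_rV (fun y => enorm (x - y)).
Proof.
move=> d T h mh.
apply: (measurableT_comp (continuous_measurable_fun (@sqrt_continuous R))) => /=.
apply: measurable_sum => i.
under eq_fun do rewrite !mxE.
by apply: measurable_funX; exact: measurable_funB.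
Qed.

Lemma mfun_rV_integrand {R : realType} {N : nat} (s p eps : R)
    (v : 'rV[R]_N -> R) (x : 'rV[R]_N) :
  mfun_rV v -> mfun_rV (fracpLap_integrand s p v x eps).
Proof.
move=> mv d T h mh.
have mu := mv _ _ _ mh.
have me := @mfun_rV_enorm R N x _ _ _ mh.
have mB : measurable_fun setT (fun t => v x - v (h t)) by exact: measurable_funB.
apply: measurable_fun_ifT => //=; first exact: measurable_fun_ler.
apply: measurable_funM; first apply: measurable_funM => //.
  apply: (measurableT_comp (@measurable_powR R (p - 2))) => /=.
  exact: measurableT_comp.
under eq_fun do rewrite -powRN.
exact: (measurableT_comp (@measurable_powR R _)).
Qed.

(** The hypotheses give [Y1 - Y2 <= - (X1 - X2)]: the bracket weighted by the reflected kernel [k']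
    is at most minus the bracket weighted by [k]. *)
Lemma paired_kernel_le {R : realDomainType} (X1 X2 Y1 Y2 k k' : R) :
  X1 <= Y2 -> Y1 <= X2 -> 0 <= k' ->
  X1 * k - X2 * k + (Y1 * k' - Y2 * k') <= (X1 - X2) * (k - k').
Proof.
move=> XY YX k'0; have : (X1 - Y2 + (Y1 - X2)) * k' <= 0.
  by apply: mulr_le0_ge0 => //; lra.
lra.
Qed.

(* The right-hand side is nonzero only when y or its reflection is in the
   truncated ball, where only one of the two reflected contributions survives. *)
Lemma paired_integrand_le {R : realType} {n : nat} (s p : R)
    (u : 'rV[R]_n.+1 -> R) (lam eps r D gam : R) (x z : 'rV[R]_n.+1) :
  let q := n.+1%:R + s * p in
  let a := u (refl lam x) in
  let b := u x in
  let M : R := `|spow p (a - b + 1) - spow p (b - a - 1)| / (lam - x1 x) `^ q in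
  let kap := gam * (2 * q / (D * D * D `^ q) * (lam - x1 x)) in
  let A := fracpLap_integrand s p (u_lam u lam) x eps in
  let B := fracpLap_integrand s p u x eps in
  1 < p -> 0 < q -> x1 x < lam -> a <= b ->
  (forall y, x1 y < lam -> w_lam u lam x <= w_lam u lam y) ->
  0 < eps -> eps <= lam - x1 x -> eps <= 1 ->
  (forall y, in_box x eps y -> b - 1 <= u y /\ u (refl lam y) <= a + 1) ->
  0 <= D -> 0 <= gam ->
  (forall y, in_box z r y ->
     [/\ x1 y <= x1 x - 1, 1 <= lam - x1 y, enorm (x - y) <= D,
         enorm (x - refl lam y) <= D &
         spow p (a - u (refl lam y)) - spow p (b - u y) <= - gam]) ->
  forall y,
    A y - B y + (A (refl lam y) - B (refl lam y))
      + (if in_box z r y then kap else 0)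
    <= (if in_box x eps y then M else 0)
       + (if in_box x eps (refl lam y) then M else 0).
Proof.
move=> q a b M kap A B p1 q0 xlam ab hmin eps0 epsd eps1 hnear D0 gam0 hK.
have dl0 : 0 < lam - x1 x by rewrite subr_gt0.
have M0 : 0 <= M by rewrite divr_ge0 ?powR_ge0.
have kap0 : 0 <= kap.
  by rewrite !mulr_ge0 ?invr_ge0 ?mulr_ge0 ?powR_ge0 //; exact: ltW.
have kapE : kap = gam * (2 * q / (D * D * D `^ q) * (lam - x1 x)) by [].
have ME : M = `|spow p (a - b + 1) - spow p (b - a - 1)| / (lam - x1 x) `^ q by [].
clearbody kap M.
(* Swapping [y] with its reflection preserves the sum of brackets, and the box around [z] lies on
   the side [x1 y < lam]; so one [M] term on the closed half-space is enough. *)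
suff half y : x1 y <= lam ->
    A y - B y + (A (refl lam y) - B (refl lam y))
      + (if in_box z r y then kap else 0)
    <= (if in_box x eps y then M else 0).
  clearbody A B => y; have [ylam|ylam] := leP (x1 y) lam.
    apply: le_trans (half _ ylam) _; rewrite lerDl; by case: ifP.
  have /half : x1 (refl lam y) <= lam by rewrite x1_refl; lra.
  rewrite reflK.
  have -> : in_box z r y = false.
    by apply/negP => /hK[_ H _ _ _]; move: H; lra.
  have : 0 <= (if in_box z r (refl lam y) then kap else 0) by case: ifP.
  move: (if in_box z r (refl lam y) then _ else _) => kap'.
  have : 0 <= (if in_box x eps y then M else 0) by case: ifP.
  move: (if in_box x eps y then _ else _) => M1.
  move: (if in_box x eps (refl lam y) then _ else _) => M2.
  by lra.
move=> ylam.
have sqrE := enorm_refl_sqr lam x y.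
set d := enorm (x - y) in sqrE *.
set d' := enorm (x - refl lam y) in sqrE *.
have d0 : 0 <= d by exact: enorm_ge0.
have d'0 : 0 <= d' by exact: enorm_ge0.
have h0 : 0 <= (lam - x1 x) * (lam - x1 y) by rewrite mulr_ge0 ?subr_ge0 // ltW.
have dd' : d <= d'.
  by rewrite -(@ler_pXn2r _ 2)// ?nnegrE// sqrE; lra.
have d'dl : lam - x1 x <= d'.
  have := coord_le_enorm (x - refl lam y) ord0.
  rewrite -/d' !mxE eqxx ler_norml -/(x1 x) -/(x1 y); lra.
have d'1 : 0 < d' by exact: lt_le_trans d'dl.
rewrite /A /B /fracpLap_integrand /u_lam reflK -/a -/b -/d -/d' -/q.
(* The reflected point is never truncated, only [y] itself can be. *)
have -> : eps <= d' by exact: le_trans epsd _.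
rewrite -!/(spow _ _).
set al := u (refl lam y); set be := u y.
have yQ : d < eps -> in_box x eps y by exact: enorm_lt_in_box.
have yxd : `|x1 x - x1 y| <= d.
  by have := coord_le_enorm (x - y) ord0; rewrite !mxE.
have hnear' : in_box x eps y -> b - 1 <= be /\ al <= a + 1 by exact: hnear.
have hK' := hK y; rewrite -/d -/d' -/al -/be in hK'.
have w_xy : x1 y < lam -> a - b <= al - be by exact: hmin.
(* Minimality covers only the open half-space; on the hyperplane [y] is fixed by the reflection. *)
have w_hyp : x1 y = lam -> al = be.
  move=> yE; rewrite /al /be; congr u; apply/rowP => i; rewrite mxE.
  by case: eqP => // ->; rewrite -/(x1 y) yE; ring.
clear hnear hK hmin; clearbody a b al be d d'; clear A B; clearbody q.
(* If [d < eps], only the reflected contribution survives. Being near [x], it is controlled by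
   [u y >= b - 1] and [u (refl lam y) <= a + 1], which explains the arguments of [spow] in [M]. *)
have [epsd'|depsd] := leP eps d; last first.
  have yQ' := yQ depsd; have [be1 al1] := hnear' yQ'.
  have -> : in_box z r y = false.
    by apply/negP => /hK'[H _ _ _ _]; move: yxd; rewrite ler_norml; lra.
  rewrite yQ' subrr add0r addr0 -mulrBl.
  have S1 : spow p (a - be) <= spow p (a - b + 1) by apply: spow_le => //; lra.
  have S2 : spow p (b - a - 1) <= spow p (b - al) by apply: spow_le => //; lra.
  have S3 := ler_norm (spow p (a - b + 1) - spow p (b - a - 1)).
  apply: (@le_trans _ _ (`|spow p (a - b + 1) - spow p (b - a - 1)| / d' `^ q)).
    rewrite ler_wpM2r ?invr_ge0 ?powR_ge0//.
    by apply: le_trans S3; exact: lerB.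
  rewrite ME ler_wpM2l// lef_pV2 ?posrE ?powR_gt0//.
  by apply: ge0_ler_powR; rewrite ?nnegrE // ltW.
have d1 : 0 < d by exact: lt_le_trans epsd'.
have kk' : (d' `^ q)^-1 <= (d `^ q)^-1.
  rewrite lef_pV2 ?posrE ?powR_gt0//.
  by apply: ge0_ler_powR; rewrite ?nnegrE // ltW.
have k'0 : 0 <= (d' `^ q)^-1 by rewrite invr_ge0 powR_ge0.
have w_le : a - al <= b - be.
  by case: (ltgtP (x1 y) lam) ylam => // [/w_xy|/w_hyp] + _; lra.
have X0 := spow_le p1 w_le.
have Y1 : spow p (a - al) <= spow p (b - al) by apply: spow_le => //; lra.
have Y2 : spow p (a - be) <= spow p (b - be) by apply: spow_le => //; lra.
have main := paired_kernel_le ((d `^ q)^-1) Y1 Y2 k'0.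
apply: (@le_trans _ _ 0); last by case: ifP.
case: ifPn => [yK|_]; last first.
  by rewrite addr0 (le_trans main)// mulr_le0_ge0 // ?subr_le0 ?subr_ge0.
have [yx yl dD d'D Xgam] := hK' yK.
have gap := @powR_inv_gap_sqr _ q d d' D _ q0 d1 d'0 dD d'D h0 sqrE.
have c0 : 0 <= 2 * q / (D * D * D `^ q).
  by rewrite divr_ge0 ?mulr_ge0 ?powR_ge0 // ltW.
(* On the box [lam - x1 y >= 1], so the product of the two distances is at least [lam - x1 x]. *)
have gap' : 2 * q / (D * D * D `^ q) * (lam - x1 x) <= (d `^ q)^-1 - (d' `^ q)^-1.
  by apply: le_trans gap; apply: ler_wpM2l => //; rewrite ler_peMr// ltW.
have K1 : kap <= gam * ((d `^ q)^-1 - (d' `^ q)^-1) by rewrite kapE ler_wpM2l.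
have K2 : (spow p (a - al) - spow p (b - be)) * ((d `^ q)^-1 - (d' `^ q)^-1)
    <= - gam * ((d `^ q)^-1 - (d' `^ q)^-1).
  by apply: ler_wpM2r => //; rewrite subr_ge0.
apply: le_trans (lerD (le_trans main K2) K1) _.
by rewrite mulNr addNr.
Qed.

(** * Integration of the paired estimate *)

Lemma mfun_rVD {R : realType} {N : nat} (f g : 'rV[R]_N -> \bar R) :
  mfun_rV f -> mfun_rV g -> mfun_rV (fun y => (f y + g y)%E).
Proof.
move=> mf mg d T h mh; exact: (emeasurable_funD (mf _ _ _ mh) (mg _ _ _ mh)).
Qed.

Lemma mfun_rV_EFin {R : realType} {N : nat} (f : 'rV[R]_N -> R) :
  mfun_rV f -> mfun_rV (fun y => (f y)%:E).
Proof. by move=> mf d T h mh; apply/measurable_EFinP; exact: mf. Qed.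

Lemma mfun_rV_pos {R : realType} {N : nat} (f : 'rV[R]_N -> R) :
  mfun_rV f -> mfun_rV (fun y => (Num.max (f y) 0)%:E).
Proof.
move=> mf; apply: mfun_rV_EFin => d T h mh.
exact: (measurable_maxr (mf _ _ _ mh) (measurable_cst _)).
Qed.

Lemma mfun_rV_opp {R : realType} {N : nat} (f : 'rV[R]_N -> R) :
  mfun_rV f -> mfun_rV (fun y => - f y).
Proof.
by move=> mf d T h mh; have := mf _ _ _ mh; exact: measurable_funN.
Qed.

Lemma mfun_rV_box {R : realType} {N : nat} (z : 'rV[R]_N) (r c : R) :
  mfun_rV (fun y => (if in_box z r y then c else 0)%:E).
Proof.
apply: mfun_rV_EFin => d T h mh.
by apply: measurable_fun_ifT => //; exact: (@mfun_rV_in_box R N z r _ _ h mh).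
Qed.

(* Symmetrizing under the reflection doubles all integrals, so no splitting of
   the domain along the hyperplane is needed. *)
Lemma lebN_sint_paired_le {R : realType} {n : nat} (lam r e kap M : R)
    (A B : 'rV[R]_n.+1 -> R) (x z : 'rV[R]_n.+1) :
  mfun_rV A -> mfun_rV B ->
  lebN_sint A \is a fin_num -> lebN_sint B \is a fin_num ->
  0 <= r -> 0 <= e -> 0 <= kap -> 0 <= M ->
  (forall y, A y - B y + (A (refl lam y) - B (refl lam y))
               + (if in_box z r y then kap else 0)
             <= (if in_box x e y then M else 0)
                + (if in_box x e (refl lam y) then M else 0)) ->
  fine (lebN_sint A) - fine (lebN_sint B) + kap * (2 * r) ^+ n.+1 / 2
  <= M * (2 * e) ^+ n.+1.
Proof.
(* A finite difference forces the integrals of both the positive and the negative part to be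
   finite. *)
move=> mA mB; rewrite /lebN_sint fin_numB => /andP[Apf Anf].
rewrite fin_numB => /andP[Bpf Bnf].
move=> r0 e0 kap0 M0 H.
pose Ap y := (Num.max (A y) 0)%:E; pose An y := (Num.max (- A y) 0)%:E.
pose Bp y := (Num.max (B y) 0)%:E; pose Bn y := (Num.max (- B y) 0)%:E.
pose k y := (if in_box z r y then kap else 0)%:E.
pose m y := (if in_box x e y then M else 0)%:E.
have mAp : mfun_rV Ap by exact: mfun_rV_pos.
have mAn : mfun_rV An by exact/mfun_rV_pos/mfun_rV_opp.
have mBp : mfun_rV Bp by exact: mfun_rV_pos.
have mBn : mfun_rV Bn by exact/mfun_rV_pos/mfun_rV_opp.
have mk : mfun_rV k by exact: mfun_rV_box.
have mm : mfun_rV m by exact: mfun_rV_box.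
have max0 (t : R) : (0 <= (Num.max t 0)%:E)%E by rewrite lee_fin le_max lexx orbT.
have Ap0 y : (0 <= Ap y)%E by exact: max0.
have An0 y : (0 <= An y)%E by exact: max0.
have Bp0 y : (0 <= Bp y)%E by exact: max0.
have Bn0 y : (0 <= Bn y)%E by exact: max0.
have k0 y : (0 <= k y)%E by rewrite lee_fin; case: ifP.
have m0 y : (0 <= m y)%E by rewrite lee_fin; case: ifP.
(* [A - B] is [F - G] with [F] and [G] nonnegative, so the inequality is integrated without any
   subtraction of integrals. *)
pose F y := (Ap y + Bn y)%E; pose G y := (An y + Bp y)%E.
pose FF y := (F y + F (refl lam y))%E; pose GG y := (G y + G (refl lam y))%E.
pose mm' y := (m y + m (refl lam y))%E.
have mF : mfun_rV F by exact: mfun_rVD.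
have mG : mfun_rV G by exact: mfun_rVD.
have mFF : mfun_rV FF by apply: mfun_rVD => //; exact: mfun_rV_refl.
have mGG : mfun_rV GG by apply: mfun_rVD => //; exact: mfun_rV_refl.
have mmm : mfun_rV mm' by apply: mfun_rVD => //; exact: mfun_rV_refl.
have F0 y : (0 <= F y)%E by exact: adde_ge0.
have G0 y : (0 <= G y)%E by exact: adde_ge0.
have FF0 y : (0 <= FF y)%E by exact: adde_ge0.
have GG0 y : (0 <= GG y)%E by exact: adde_ge0.
have mm0 y : (0 <= mm' y)%E by exact: adde_ge0.
have : (lebN_int (fun y => FF y + k y) <= lebN_int (fun y => GG y + mm' y))%E.
  apply: le_lebN_int; [by move=> y; exact: adde_ge0|exact: mfun_rVD|exact: mfun_rVD|].
  move=> y; rewrite /FF /GG /mm' /F /G /Ap /An /Bp /Bn /k /m -!EFinD lee_fin.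
  have max_sub (t : R) : Num.max t 0 - Num.max (- t) 0 = t.
    by case: (leP t 0) => ?; case: leP; lra.
  have := H y.
  have := max_sub (A y); have := max_sub (A (refl lam y)).
  have := max_sub (B y); have := max_sub (B (refl lam y)).
  lra.
have lebN_FF : lebN_int FF = ((lebN_int Ap + lebN_int Bn)
    + (lebN_int Ap + lebN_int Bn))%E.
  rewrite (@lebN_intD _ _ F (fun y => F (refl lam y)))//; last exact: mfun_rV_refl.
  by rewrite lebN_int_refl// (@lebN_intD _ _ Ap Bn).
have lebN_GG : lebN_int GG = ((lebN_int An + lebN_int Bp)
    + (lebN_int An + lebN_int Bp))%E.
  rewrite (@lebN_intD _ _ G (fun y => G (refl lam y)))//; last exact: mfun_rV_refl.
  by rewrite lebN_int_refl// (@lebN_intD _ _ An Bp).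
have lebN_mm : lebN_int mm' = (lebN_int m + lebN_int m)%E.
  rewrite (@lebN_intD _ _ m (fun y => m (refl lam y)))//; last exact: mfun_rV_refl.
  by rewrite lebN_int_refl.
(* The box term [k] is the only one not doubled, hence the division by 2 in the conclusion. *)
rewrite (@lebN_intD _ _ FF k)// (@lebN_intD _ _ GG mm')//.
rewrite lebN_FF lebN_GG lebN_mm !lebN_int_box//.
have Apf' : lebN_int Ap \is a fin_num by exact: Apf.
have Anf' : lebN_int An \is a fin_num by exact: Anf.
have Bpf' : lebN_int Bp \is a fin_num by exact: Bpf.
have Bnf' : lebN_int Bn \is a fin_num by exact: Bnf.
rewrite -/Ap -/An -/Bp -/Bn.
rewrite -(fineK Apf') -(fineK Anf') -(fineK Bpf') -(fineK Bnf') -!EFinD lee_fin /=.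
lra.
Qed.

(** * The limit as the truncation radius tends to 0 *)

Lemma fin_num_fracpLap_trunc {R : realType} {N : nat} (C s p eps : R)
    (v : 'rV[R]_N -> R) (x : 'rV[R]_N) :
  0 < C -> fracpLap_trunc C s p v x eps \is a fin_num ->
  lebN_sint (fracpLap_integrand s p v x eps) \is a fin_num.
Proof.
rewrite /fracpLap_trunc => C0; case: (lebN_sint _) => [//||].
  by rewrite gt0_muley ?lte_fin.
by rewrite gt0_muleNy ?lte_fin.
Qed.

(** Convergence to a finite limit makes the truncated integrals finite for small [eps], so the limit
    can be handled among real numbers. *)
Lemma fracpLap_cvg {R : realType} {N : nat} (C s p l : R)
    (v : 'rV[R]_N -> R) (x : 'rV[R]_N) :
  0 < C -> fracpLap_trunc C s p v x eps @[eps --> 0^'+] --> l%:E ->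
  [/\ fracpLap C s p v x = l,
      \forall eps \near 0^'+,
        lebN_sint (fracpLap_integrand s p v x eps) \is a fin_num &
      C * fine (lebN_sint (fracpLap_integrand s p v x eps)) @[eps --> 0^'+] --> l].
Proof.
move=> C0 vl; have /fine_cvgP[vfin vfine] := vl.
split; first by rewrite /fracpLap (cvg_lim _ vl).
  by apply: filterS vfin => eps; exact: fin_num_fracpLap_trunc.
apply: cvg_trans vfine; apply: near_eq_cvg.
apply: filterS vfin => eps /(fin_num_fracpLap_trunc C0) vf.
by rewrite /= /fracpLap_trunc fineM.
Qed.

(** For fixed [x] the constant [M] does not depend on [eps], so the error, of order [eps ^+ n.+1],
    disappears in the limit while the gain from the box around [z] remains. *)
Lemma fracpLap_reflection_le {R : realType} {n : nat} (C s p : R)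
    (u : 'rV[R]_n.+1 -> R) (lam r D gam : R) (x z : 'rV[R]_n.+1) :
  let q := n.+1%:R + s * p in
  0 < C -> 1 < p -> 0 < q -> continuous u -> x1 x < lam ->
  w_lam u lam x <= 0 ->
  (forall y, x1 y < lam -> w_lam u lam x <= w_lam u lam y) ->
  0 <= r -> 0 <= D -> 0 <= gam ->
  (forall y, in_box z r y ->
     [/\ x1 y <= x1 x - 1, 1 <= lam - x1 y, enorm (x - y) <= D,
         enorm (x - refl lam y) <= D &
         spow p (u (refl lam x) - u (refl lam y)) - spow p (u x - u y) <= - gam]) ->
  fracpLap_exists C s p (u_lam u lam) x -> fracpLap_exists C s p u x ->
  fracpLap C s p (u_lam u lam) x - fracpLap C s p u x <=
  - (C * (gam * (2 * q / (D * D * D `^ q) * (lam - x1 x)) * (2 * r) ^+ n.+1 / 2)).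
Proof.
move=> q C0 p1 q0 cu xlam wx hmin r0 D0 gam0 hK [la /(fracpLap_cvg C0)[-> afin acvg]]
  [lb /(fracpLap_cvg C0)[-> bfin bcvg]].
set kap := gam * _; set a := u (refl lam x); set b := u x.
have dl0 : 0 < lam - x1 x by rewrite subr_gt0.
have ab : a <= b by move: wx; rewrite /w_lam /u_lam -/a -/b subr_le0.
pose M := `|spow p (a - b + 1) - spow p (b - a - 1)| / (lam - x1 x) `^ q.
have M0 : 0 <= M by rewrite divr_ge0 ?powR_ge0.
have kap0 : 0 <= kap.
  by rewrite !mulr_ge0 ?invr_ge0 ?mulr_ge0 ?powR_ge0 //; exact: ltW.
have mu := mfun_rV_continuous cu.
have mul : mfun_rV (u_lam u lam) by exact: mfun_rV_refl.
have [e1 e10 He1] := continuous_in_box x cu ltr01.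
have [e2 e20 He2] := continuous_in_box (refl lam x) cu ltr01.
have e30 : 0 < e2 / 3 by rewrite divr_gt0.
(* Although [M] may blow up as [x] nears the hyperplane, [x] is fixed here. *)
have err : C * (M * (2 * eps) ^+ n.+1) @[eps --> 0^'+] --> (0 : R).
  have : C * (M * (2 * eps) ^+ n.+1) @[eps --> 0^'+] -->
      C * (M * (2 * 0) ^+ n.+1).
    apply: cvg_at_right_filter; apply: cvgMr; apply: cvgMr.
    apply: (@cvg_comp _ _ _ (fun t : R => 2 * t) (fun t => t ^+ n.+1)).
      by apply: cvgMr; exact: cvg_id.
    exact: exprn_continuous.
  by rewrite mulr0 exprS mul0r !mulr0.
have lhs : C * fine (lebN_sint (fracpLap_integrand s p (u_lam u lam) x eps))
    - C * fine (lebN_sint (fracpLap_integrand s p u x eps))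
    + C * (kap * (2 * r) ^+ n.+1 / 2) @[eps --> 0^'+] -->
    la - lb + C * (kap * (2 * r) ^+ n.+1 / 2).
  by apply: cvgD; [exact: cvgB|exact: cvg_cst].
suff : la - lb + C * (kap * (2 * r) ^+ n.+1 / 2) <= 0 by lra.
apply: (ler_cvg_to lhs err).
near=> eps.
have eps0 : 0 < eps by near: eps; exact: nbhs_right_gt.
have eps1 : eps <= 1 by near: eps; exact: nbhs_right_le.
have epsd : eps <= lam - x1 x by near: eps; exact: nbhs_right_le.
have epse1 : eps <= e1 by near: eps; exact: nbhs_right_le.
have epse2 : eps <= e2 / 3 by near: eps; exact: nbhs_right_le.
have af : lebN_sint (fracpLap_integrand s p (u_lam u lam) x eps) \is a fin_num.
  by near: eps.
have bf : lebN_sint (fracpLap_integrand s p u x eps) \is a fin_num by near: eps.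
have hnear y : in_box x eps y -> b - 1 <= u y /\ u (refl lam y) <= a + 1.
  move=> yQ; split.
    by have := He1 _ (in_boxW epse1 yQ); rewrite -/b ler_norml; lra.
  have /He2 : in_box (refl lam x) e2 (refl lam y).
    apply: (@in_boxW _ _ _ _ (3 * eps)); first by lra.
    by apply: refl_in_box; rewrite ?subrr ?normr0// ltW.
  by rewrite -/a ler_norml; lra.
have := lebN_sint_paired_le (mfun_rV_integrand s p eps x mul)
  (mfun_rV_integrand s p eps x mu) af bf r0 (ltW eps0) kap0 M0
  (paired_integrand_le p1 q0 xlam ab hmin eps0 epsd eps1 hnear D0 gam0 hK).
by rewrite -(ler_pM2l C0) !mulrDr mulrN.
Unshelve. all: by end_near.
Qed.

(** * Limit superior, boundary of the half-space, and the theorem *)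

(** The limit superior is an infimum of suprema over sets of the filter, and the set where the bound
    holds is one of them. *)
Lemma limn_esup_le_near {R : realType} (v : nat -> \bar R) (l : \bar R) :
  (\forall k \near \oo, (v k <= l)%E) -> (limn_esup v <= l)%E.
Proof.
move=> vl; apply: (@le_trans _ _ (ereal_sup (v @` [set k | (v k <= l)%E]))).
  by apply: ereal_inf_lbound; exists [set k | (v k <= l)%E].
by apply: ge_ereal_sup => _ [k /= kl <-].
Qed.

Lemma x1_boundary_Sigma {R : realType} {n : nat} (lam : R) (xo : 'rV[R]_n.+1) :
  xo \in closure (@Sigma R n lam) `\` interior (@Sigma R n lam) -> x1 xo = lam.
Proof.
rewrite inE => -[cl ni]; apply/eqP; rewrite eq_le; apply/andP; split.
  apply/ler_addgt0Pr => e e0.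
  have [y [yS /forallP yB]] := cl _ (nbhs_in_box xo e0).
  have := yB ord0; rewrite ler_norml -/(x1 y) -/(x1 xo).
  by move: yS; rewrite /Sigma /=; lra.
rewrite leNgt; apply/negP => xl; apply: ni.
have h0 : 0 < (lam - x1 xo) / 2 by lra.
apply: filterS (nbhs_in_box xo h0) => y /forallP /(_ ord0).
by rewrite /Sigma /= ler_norml -/(x1 y) -/(x1 xo); lra.
Qed.

Theorem theorem2p3 (R : realType) (n : nat) (C s p : R)
  (u : 'rV[R]_n.+1 -> R) (lam_o : R) (lam : nat -> R)
  (x : nat -> 'rV[R]_n.+1) (xo : 'rV[R]_n.+1) :
  0 < C -> 0 < s -> s < 1 -> 1 < p ->
  C11_loc u -> L_sp s p u ->
  (forall y, Sigma lam_o y -> 0 < w_lam u lam_o y) ->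
  {homo lam : i j / (i <= j)%N >-> j <= i} ->
  lam @ \oo --> lam_o ->
  (forall k, Sigma (lam k) (x k)) ->
  (forall k, forall y, Sigma (lam k) y -> w_lam u (lam k) (x k) <= w_lam u (lam k) y) ->
  (forall k, w_lam u (lam k) (x k) <= 0) ->
  x @ \oo --> xo ->
  xo \in closure (Sigma lam_o) `\` interior (Sigma lam_o) ->
  (forall k, fracpLap_exists C s p (u_lam u (lam k)) (x k)) ->
  (forall k, fracpLap_exists C s p u (x k)) ->
  (limn_esup (fun k =>
     ((fracpLap C s p (u_lam u (lam k)) (x k) - fracpLap C s p u (x k))
        / `|lam k - x1 (x k)|)%:E) < 0)%E.
Proof.
move=> C0 s0 _ p1 [du _] _ w0 _ lamcv xS hmin wx xcv /x1_boundary_Sigma xo1 ea eb.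
have cu : continuous u by move=> y; exact: differentiable_continuous.
(* The shift 3 leaves room for errors of size 1 in [y], [x k] and [lam k]: points of the box stay at
   least 1 to the left of [x k] and of the hyperplane. *)
pose z : 'rV[R]_n.+1 := \row_i (if i == ord0 then xo 0 i - 3 else xo 0 i).
have z1 : x1 z = lam_o - 3 by rewrite /x1 mxE eqxx -xo1.
have wz : 0 < u (refl lam_o z) - u z by apply: w0; rewrite /Sigma /= z1; lra.
(* Each value of [u] will move by at most [eta / 2], so each difference by at most [eta]; of the gap
   [4 * eta] at least [2 * eta] remains, and [gam] is positive. *)
pose eta := (u (refl lam_o z) - u z) / 4.
have eta0 : 0 < eta by rewrite divr_gt0.
have eta20 : 0 < eta / 2 by rewrite divr_gt0.
have [r1 r10 Hr1] := continuous_in_box z cu eta20.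
have [r2 r20 Hr2] := continuous_in_box (refl lam_o z) cu eta20.
have [r3 r30 Hr3] := continuous_in_box xo cu eta20.
(* The thirds absorb the factor 3 of [refl_in_box]. *)
pose r := Num.min 1 (Num.min r1 (Num.min (r2 / 3) (r3 / 3))).
have r0 : 0 < r by rewrite !lt_min ltr01 r10 !divr_gt0.
have [rle1 rler1 rler2 rler3] : [/\ r <= 1, r <= r1, r <= r2 / 3 & r <= r3 / 3].
  by have := lexx r; rewrite {2}/r !le_min => /and4P[].
pose q := n.+1%:R + s * p.
have q0 : 0 < q.
  by rewrite ltr_wpDr ?ltr0n// mulr_ge0 ?ltW// (lt_trans ltr01).
(* For y within 1 of z, the coordinates of x k - y and of its reflected
   counterpart are at most 7 in absolute value. *)
pose D := Num.sqrt (n.+1%:R * 7 ^+ 2 : R).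
have D0 : 0 < D by rewrite sqrtr_gt0 mulr_gt0 ?ltr0n ?exprn_gt0.
pose gam := spow p (u xo - u z - eta) - spow p (u xo - u (refl lam_o z) + eta).
have gam0 : 0 < gam by rewrite subr_gt0 spow_lt//; rewrite /eta; lra.
(* The bound of [fracpLap_reflection_le] divided by delta_k; it does not involve [k]. *)
pose c := C * (gam * (2 * q / (D * D * D `^ q)) * (2 * r) ^+ n.+1 / 2).
have K0 : 0 < 2 * q / (D * D * D `^ q).
  by rewrite divr_gt0// ?mulr_gt0// powR_gt0.
have c0 : 0 < c.
  have r20' : 0 < (2 * r) ^+ n.+1 by rewrite exprn_gt0// mulr_gt0.
  exact: (mulr_gt0 C0 (divr_gt0 (mulr_gt0 (mulr_gt0 gam0 K0) r20') (ltr0Sn R 1))).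
apply: (@le_lt_trans _ _ (- c)%:E); last by rewrite lte_fin oppr_lt0.
apply: limn_esup_le_near; near=> k.
have lamk : `|lam k - lam_o| <= r.
  by near: k; exact: (@cvgr_distC_le _ _ _ _ _ lam lam_o lamcv).
have xk : in_box xo r (x k).
  by near: k; exact: (xcv _ (nbhs_in_box xo r0)).
have dl0 : 0 < lam k - x1 (x k) by rewrite subr_gt0; exact: xS.
rewrite lee_fin gtr0_norm// ler_pdivrMr//.
(* As [xo] lies on the limiting hyperplane, the reflections of [x k] also approach [xo], so both
   values of [u] are close to [u xo]. *)
have refl_xo : refl lam_o xo = xo.
  apply/rowP => i; rewrite mxE; case: eqP => // ->.
  by rewrite -/(x1 xo) xo1; ring.
have uxk : `|u (x k) - u xo| <= eta / 2.
  by apply/Hr3/(in_boxW _ xk); lra.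
have urk : `|u (refl (lam k) (x k)) - u xo| <= eta / 2.
  apply/Hr3; rewrite -refl_xo; apply: in_boxW (refl_in_box (ltW r0) xk lamk).
  by lra.
have -> : - c * (lam k - x1 (x k)) =
  - (C * (gam * (2 * q / (D * D * D `^ q) * (lam k - x1 (x k)))
      * (2 * r) ^+ n.+1 / 2)) by rewrite /c; ring.
apply: (@fracpLap_reflection_le _ _ C s p u (lam k) r D gam (x k) z) => //.
- exact: xS.
- exact: hmin.
- exact: ltW.
- exact: ltW.
- exact: ltW.
move=> y yK.
have uyk : `|u y - u z| <= eta / 2 by apply/Hr1/(in_boxW _ yK).
have uryk : `|u (refl (lam k) y) - u (refl lam_o z)| <= eta / 2.
  apply/Hr2; apply: in_boxW (refl_in_box (ltW r0) yK lamk).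
  by lra.
move: lamk xk yK => /[!ler_norml] lamk /forallP xk /forallP yK.
have x1k := xk ord0; have y1k := yK ord0.
rewrite -/(x1 _) -/(x1 _) ler_norml xo1 in x1k.
rewrite -/(x1 _) -/(x1 _) ler_norml z1 in y1k.
split.
- by lra.
- by lra.
- apply: enorm_le => // i; have := xk i; have := yK i.
  rewrite !mxE !ler_norml; case: ifP => _; lra.
- apply: enorm_le => // i; have := xk i; have := yK i.
  rewrite !mxE !ler_norml; case: eqP => [->|_]; rewrite -?/(x1 _) ?xo1; lra.
move: uxk urk uyk uryk; rewrite !ler_norml => uxk urk uyk uryk.
rewrite /gam opprB; apply: lerB; apply: spow_le => //; lra.
Unshelve. all: by end_near.
Qed.
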